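(* For all integers $n \geq 0$, the following three congruences hold: \begin{align*} \overline{spt2}(36n+30) &\equiv 0 \pmod{4},\\ \overline{spt2}(48n+34) &\equiv 0 \pmod{4},\\ \overline{spt2}(72n+42) &\equiv 0 \pmod{4}. \end{align*}
   Context: An overpartition of a positive integer $n$ is a partition of $n$ (a non-increasing sequence of positive integers with sum $n$) in which the first occurrence of each distinct part may or may not be overlined. The function $\overline{spt2}(n)$ is the total number of smallest parts in the overpartitions of $n$ whose smallest part is even and is not overlined. That is, $\overline{spt2}(n)$ is the sum, over all overpartitions of $n$ whose smallest part is even and has no overlined occurrence, of the number of times the smallest part occurs. For example, $\overline{spt2}(4)=3$: among the 14 overpartitions of $4$, the ones that contribute are $4$ (contributing 1) and $2+2$ (contributing 2). *)

(* Defs.v *)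
From mathcomp Require Import all_boot.

Set Implicit Arguments.
Unset Strict Implicit.
Unset Printing Implicit Defensive.

(* The entry (m, b) is an occurrence of the part m, overlined iff b = true. *)
Definition marked_seq := seq (nat * bool).

Definition parts (s : marked_seq) : seq nat := unzip1 s.

Definition is_partition (n : nat) (p : seq nat) : bool :=
  [&& sorted geq p, all (fun m => 0 < m) p & sumn p == n].

(* If y comes after x in s and y is overlined, then x and y are not occurrences
   of the same part. *)
Definition overlined_first_only (s : marked_seq) : bool :=
  pairwise (fun x y : nat * bool => y.2 ==> (x.1 != y.1)) s.

Definition is_overpartition (n : nat) (s : marked_seq) : bool :=
  is_partition n (parts s) && overlined_first_only s.

(* The parts of an overpartition are non-increasing, so the last is the least. *)
Definition smallest_part (s : marked_seq) : nat := last 0 (parts s).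

Definition smallest_even_nonoverlined (s : marked_seq) : bool :=
  ~~ odd (smallest_part s) && ((smallest_part s, true) \notin s).

Definition num_smallest (s : marked_seq) : nat :=
  count_mem (smallest_part s) (parts s).

Definition marked_seq_of_tuple n k (t : k.-tuple ('I_n.+1 * bool)) :
  marked_seq := [seq (val x.1, x.2) | x <- t].

(* An overpartition of n has at most n entries, each with a part at most n, so
   every one of them is [marked_seq_of_tuple t] for exactly one pair (k, t). *)
Definition spt2bar (n : nat) : nat :=
  \sum_(k < n.+1)
    \sum_(t : k.-tuple ('I_n.+1 * bool) |
            is_overpartition n (marked_seq_of_tuple t)
            && smallest_even_nonoverlined (marked_seq_of_tuple t))
      num_smallest (marked_seq_of_tuple t).

(* Main.v *)
Require Import Defs.
From mathcomp Require Import all_boot all_algebra zify ring.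
Import GRing.Theory.

(** Modulo 4 an overpartition counts only if it has at most two distinct parts,
so for odd N the number [spt2bar (2 * N)] is congruent to sigma(N) plus twice
the number of solutions of 2kr + js = 2N with r odd and j > 2k.  Involutions on
the solutions of ar + bs = N turn this into 2(V + K) when N is not a square,
where V and K count the solutions of ar + 2bs = N and ar + 4bs = N; the swaps
(a, r) -> (r, a) and (b, s) -> (s, b) show that V and K have the parities of the
numbers of representations of N by x^2 + 2y^2 and by x^2 + 4y^2.

For N = 3M with M prime to 3 and not a square there is no representation
x^2 + 4y^2 = N, and multiplication by (1 - sqrt(-2)) / (1 + sqrt(-2)) or by its
inverse pairs off the representations x^2 + 2y^2 = N.  For N = 8m + 1 the number
V + K has the parity of the number of solutions of x^2 + 8yz = N with y odd, i.e.
of T + ie = m with T triangular and i odd.  By Gauss, the generating series psi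
of the triangular numbers is the product of the (1 - q^(2r)) / (1 - q^(2r - 1)),
so q psi' = psi * (sum over odd i of q^i / (1 - q^i)) over F_2, and that number
is even unless m is triangular. *)

(** * Counting solutions up to parity *)

Lemma leq_count_inj (T : eqType) (s : seq T) (P Q : pred T) (g g' : T -> T) :
  uniq s ->
  {in s, forall t, P t -> [/\ g t \in s, Q (g t) & g' (g t) = t]} ->
  count P s <= count Q s.
Proof.
move=> Us gP; rewrite -!size_filter -(size_map g).
apply: uniq_leq_size => [|y /mapP[x]].
  rewrite map_inj_in_uniq ?filter_uniq // => x y.
  rewrite !mem_filter => /andP[Px sx] /andP[Py sy] /(congr1 g').
  by have [_ _ ->] := gP x sx Px; have [_ _ ->] := gP y sy Py.
rewrite mem_filter => /andP[Px sx] ->.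
by have [gs Qg _] := gP x sx Px; rewrite mem_filter Qg.
Qed.

Lemma count_bij (T : eqType) (s : seq T) (P Q : pred T) (g g' : T -> T) :
  uniq s ->
  {in s, forall t, P t -> [/\ g t \in s, Q (g t) & g' (g t) = t]} ->
  {in s, forall t, Q t -> [/\ g' t \in s, P (g' t) & g (g' t) = t]} ->
  count P s = count Q s.
Proof.
by move=> Us gP gQ; apply/eqP;
  rewrite eqn_leq (leq_count_inj _ _ _ _ g g') ?(leq_count_inj _ _ _ _ g' g).
Qed.

(** Outside its fixed points [g] exchanges [lo] and [hi], the elements that come before,
    respectively after, their image in [s]. *)
Lemma odd_count_involution (T : eqType) (s : seq T) (P : pred T) (g : T -> T) :
  uniq s ->
  {in s, forall t, P t -> [/\ g t \in s, P (g t) & g (g t) = t]} ->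
  odd (count P s) = odd (count (fun t => P t && (g t == t)) s).
Proof.
move=> Us gP.
pose lo t := P t && (index t s < index (g t) s).
pose hi t := P t && (index (g t) s < index t s).
have E : count lo s = count hi s.
  by apply: (count_bij _ _ _ _ g g) => // t st /andP[Pt lt_t];
    have [gs Pg gg] := gP t st Pt; split; rewrite ?gg // /lo /hi Pg gg.
suff -> : count P s = count (fun t => P t && (g t == t)) s + (count lo s).*2.
  by rewrite oddD odd_double addbF.
have cE Q : count Q s = \sum_(t <- s) Q t.
  by rewrite -sum1_count big_mkcond; apply: eq_bigr => t _; case: (Q t).
rewrite -addnn {2}E !cE -!big_split /= !big_seq.
apply: eq_bigr => t st; rewrite /lo /hi.
case Pt: (P t) => //=; have [gs _ gg] := gP t st Pt.
case: eqVneq => [->|ne]; first by rewrite !ltnn.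
have : index (g t) s != index t s.
  by apply: contra ne => /eqP /(congr1 (nth t s)); rewrite !nth_index // => ->.
by case: ltngtP.
Qed.

Definition quad : Type := (nat * nat * nat * nat)%type.

Implicit Types (P Q C : nat -> nat -> nat -> nat -> bool) (g : quad -> quad).

Definition box B : seq quad :=
  let I := iota 1 B in
  [seq (x, s) | x <- [seq (y, b) | y <- [seq (a, r) | a <- I, r <- I], b <- I],
                s <- I].

Lemma mem_box B a r b s :
  ((a, r, b, s) \in box B) = [&& 0 < a <= B, 0 < r <= B, 0 < b <= B & 0 < s <= B].
Proof.
have mp (T S : eqType) (u : seq T) (v : seq S) x y :
  ((x, y) \in [seq (x, y) | x <- u, y <- v]) = (x \in u) && (y \in v).
  apply/allpairsP/andP => [[[x' y'] /= [xu yv [-> ->]]] //|[xu yv]].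
  by exists (x, y).
by rewrite /box !mp !mem_iota !add1n !ltnS -!andbA.
Qed.

Lemma box_uniq B : uniq (box B).
Proof.
by do 3 (apply: allpairs_uniq; rewrite ?iota_uniq //; last by move=> [? ?] [? ?]).
Qed.


(** In the equations below positivity bounds every coordinate of a solution, so a large enough box
    loses none. *)
Definition cnt B (P : nat -> nat -> nat -> nat -> bool) :=
  count (fun t : quad => let: (a, r, b, s) := t in P a r b s) (box B).

Lemma cntE B P :
  cnt B P = \sum_(1 <= a < B.+1) \sum_(1 <= r < B.+1)
              \sum_(1 <= b < B.+1) \sum_(1 <= s < B.+1) P a r b s.
Proof.
rewrite /cnt -sum1_count big_mkcond /box /= !big_allpairs /index_iota subSS subn0.
do 4 (apply: eq_bigr => ? _).
by case: (P _ _ _ _).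
Qed.

Lemma eq_cnt B P Q :
  (forall a r b s, 0 < a <= B -> 0 < r <= B -> 0 < b <= B -> 0 < s <= B ->
     P a r b s = Q a r b s) ->
  cnt B P = cnt B Q.
Proof.
move=> E; apply: eq_in_count => -[[[a r] b] s].
by rewrite mem_box => /and4P[Ha Hr Hb Hs]; apply: E.
Qed.

Lemma cnt_split B C P :
  cnt B P = cnt B (fun a r b s => P a r b s && C a r b s)
          + cnt B (fun a r b s => P a r b s && ~~ C a r b s).
Proof.
rewrite !cntE -big_split; apply: eq_bigr => a _.
rewrite -big_split; apply: eq_bigr => r _.
rewrite -big_split; apply: eq_bigr => b _.
rewrite -big_split; apply: eq_bigr => s _.
by case: P => //=; case: C.
Qed.

(** Naming the image by existentials lets [reflexivity] evaluate a map given by pattern matching;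
    only arithmetic on the coordinates remains. *)
Lemma cnt_bij B P Q g g' :
  (forall a r b s, (a, r, b, s) \in box B -> P a r b s ->
     exists a' r' b' s', [/\ g (a, r, b, s) = (a', r', b', s'),
      (a', r', b', s') \in box B, Q a' r' b' s' & g' (a', r', b', s') = (a, r, b, s)]) ->
  (forall a r b s, (a, r, b, s) \in box B -> Q a r b s ->
     exists a' r' b' s', [/\ g' (a, r, b, s) = (a', r', b', s'),
      (a', r', b', s') \in box B, P a' r' b' s' & g (a', r', b', s') = (a, r, b, s)]) ->
  cnt B P = cnt B Q.
Proof.
move=> gP gQ; apply: (count_bij _ _ _ _ g g') (box_uniq B) _ _ => -[[[a r] b] s] st Pt.
  by have [a' [r' [b' [s' [-> ? ? ->]]]]] := gP _ _ _ _ st Pt.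
by have [a' [r' [b' [s' [-> ? ? ->]]]]] := gQ _ _ _ _ st Pt.
Qed.

Lemma odd_cnt_involution B P g :
  (forall a r b s, (a, r, b, s) \in box B -> P a r b s ->
     exists a' r' b' s', [/\ g (a, r, b, s) = (a', r', b', s'),
      (a', r', b', s') \in box B, P a' r' b' s' & g (a', r', b', s') = (a, r, b, s)]) ->
  odd (cnt B P) =
  odd (cnt B (fun a r b s => P a r b s && (g (a, r, b, s) == (a, r, b, s)))).
Proof.
move=> gP; rewrite /cnt (odd_count_involution _ _ _ g (box_uniq B)).
  by congr odd; apply: eq_count => -[[[a r] b] s].
move=> [[[a r] b] s] st Pt.
by have [a' [r' [b' [s' [-> ? ? ->]]]]] := gP _ _ _ _ st Pt.
Qed.

Lemma cnt0 B P :
  (forall a r b s, (a, r, b, s) \in box B -> ~~ P a r b s) -> cnt B P = 0.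
Proof.
move=> P0; apply/eqP; rewrite /cnt -leqn0 leqNgt -has_count; apply/hasP.
by move=> [[[[a r] b] s] st]; apply/negP/P0.
Qed.

(** * Solutions of ar + bs = N *)

Ltac quads :=
  let a := fresh "a" in let r := fresh "r" in let b := fresh "b" in
  let s := fresh "s" in
  move=> a r b s; rewrite mem_box => ? ?; do 4 eexists;
  split; [reflexivity | rewrite mem_box; try nia | try nia
         | repeat (congr pair); try nia].

(** Exchanging the products [a * r] and [b * s] is an involution; a fixed point would make [N]
    even. *)
Lemma even_cnt_all N : odd N -> ~~ odd (cnt N (fun a r b s => a * r + b * s == N)).
Proof.
move=> oddN.
rewrite (odd_cnt_involution _ _ (fun '(a, r, b, s) => (b, s, a, r))); last by quads.
rewrite cnt0 // => a r b s _; apply/negP => /andP[/eqP E /eqP[*]]; nia.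
Qed.

(** A solution with r = 2r' even is a solution of bs + 2ar' = N. *)
Lemma cnt_odd_all N : odd N ->
  cnt N (fun a r b s => a * r + b * s == N) =
  cnt N (fun a r b s => (a * r + b * s == N) && odd r)
  + cnt N (fun a r b s => a * r + 2 * (b * s) == N).
Proof.
move=> oddN; rewrite (cnt_split _ (fun a r b s => odd r)); congr (_ + _).
apply: (cnt_bij _ _ _ (fun '(a, r, b, s) => (b, s, a, r./2))
                      (fun '(a, r, b, s) => (b, 2 * s, a, r))); quads.
Qed.

(* With b = 2a + c the form is ar + 2as + cs, symmetric under (a, r) <-> (s, c). *)
Lemma even_cnt_odd_odd N : odd N ->
  ~~ odd (cnt N (fun a r b s =>
     [&& a * r + b * s == N, odd r, odd b & 2 * a < b])).
Proof.
move=> oddN.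
rewrite (odd_cnt_involution _ _
  (fun '(a, r, b, s) => (s, b - 2 * a, r + 2 * s, a))); last by quads.
rewrite cnt0 // => a r b s _; apply/negP => /andP[/and4P[/eqP E ? ? ?] /eqP[*]]; nia.
Qed.

(* With a = b + c the form is br + bs + cr, symmetric under (b, s) <-> (r, c); the
   fixed points have b * (b + 2s) = N. *)
Lemma odd_cnt_gt_odd N : odd N ->
  odd (cnt N (fun a r b s => [&& a * r + b * s == N, odd r, b < a & odd b]))
  = odd (cnt N (fun a r b s => [&& a * r == N, a < r, b == 1 & s == 1])).
Proof.
move=> oddN.
rewrite (odd_cnt_involution _ _
  (fun '(a, r, b, s) => (r + s, b, r, a - b))); last by quads.
congr odd; apply: (cnt_bij _ _ _ (fun '(a, r, b, s) => (b, 2 * a - b, 1, 1))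
  (fun '(a, r, b, s) => ((a + r)./2, a, a, (r - a)./2))).
  move=> a r b s; rewrite mem_box => B /andP[/and4P[/eqP E o lt o'] /eqP[? ? _ ?]].
  subst r a; have -> : 2 * (b + s) - b = b + 2 * s by lia.
  do 4 eexists; split; [reflexivity | rewrite mem_box; nia | nia | ].
  repeat congr pair; lia.
move=> a r b s; rewrite mem_box => B /and4P[/eqP E lt /eqP b1 /eqP s1].
have oar : odd a && odd r by nia.
have [h hE] : exists h, r = a + 2 * h by exists (r - a)./2; lia.
have -> : (a + r)./2 = a + h by lia.
have -> : (r - a)./2 = h by lia.
have ha : a <= N by lia.
subst r b s.
have {}E : (a + h) * a + a * h = N by lia.
have ? : a + h <= (a + h) * a by rewrite leq_pmulr; lia.
have ? : h <= a * h by rewrite leq_pmull; lia.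
do 4 eexists; split; [reflexivity | rewrite mem_box; lia | | ].
  apply/andP; split; [apply/and4P; split; lia |].
  by apply/eqP; repeat congr pair; lia.
by repeat congr pair; lia.
Qed.

(** Halving [b] and [s] creates the coefficient 4 and turns [b < a] into [2 * b < a]; conversely [r]
    is odd because [a * r] is. *)
Lemma cnt_gt_even_even N : odd N ->
  cnt N (fun a r b s => [&& a * r + b * s == N, odd r, b < a, ~~ odd b & ~~ odd s])
  = cnt N (fun a r b s => (a * r + 4 * (b * s) == N) && (2 * b < a)).
Proof.
move=> oddN; apply: (cnt_bij _ _ _ (fun '(a, r, b, s) => (a, r, b./2, s./2))
                      (fun '(a, r, b, s) => (a, r, 2 * b, 2 * s))).
  move=> a r b s; rewrite mem_box => B /and5P[/eqP E o lt o' o''].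
  have [h hE] : exists h, b = 2 * h by exists b./2; lia.
  have [k kE] : exists k, s = 2 * k by exists s./2; lia.
  have -> : b./2 = h by lia.
  have -> : s./2 = k by lia.
  by do 4 eexists; split; [reflexivity | rewrite mem_box; subst; nia | subst; nia
     | repeat congr pair; lia].
move=> a r b s; rewrite mem_box => B /andP[/eqP E o].
by do 4 eexists; split; [reflexivity | rewrite mem_box; nia | nia
     | repeat congr pair; lia].
Qed.

(** With a = b + c the equation reads rc + b(r + s) = N, where b and r + s are even. Halving both
    creates the coefficient 4, and r < r + s becomes the condition complementary to [2 * b < a];
    equality there is excluded by parity. *)
Lemma cnt_gt_even_odd N : odd N ->
  cnt N (fun a r b s => [&& a * r + b * s == N, odd r, b < a, ~~ odd b & odd s])
  = cnt N (fun a r b s => (a * r + 4 * (b * s) == N) && ~~ (2 * b < a)).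
Proof.
move=> oddN; apply: (cnt_bij _ _ _
  (fun '(a, r, b, s) => (r, a - b, (r + s)./2, b./2))
  (fun '(a, r, b, s) => (r + 2 * s, a, 2 * s, 2 * b - a))).
  move=> a r b s; rewrite mem_box => B /and5P[/eqP E o lt o' o''].
  have [h hE] : exists h, b = 2 * h by exists b./2; lia.
  have [k kE] : exists k, r + s = 2 * k by exists (r + s)./2; lia.
  have -> : b./2 = h by lia.
  have -> : (r + s)./2 = k by lia.
  have [c cE] : exists c, a = 2 * h + c by exists (a - b); lia.
  have -> : a - b = c by lia.
  have hk : h * (r + s) = h * (2 * k) by rewrite kE.
  have ? : r <= a * r by rewrite leq_pmull; lia.
  have ? : s <= b * s by rewrite leq_pmull; lia.
  subst a b; have {}E : r * c + 4 * (k * h) = N by lia.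
  do 4 eexists; split; [reflexivity | rewrite mem_box; lia | |
    by repeat congr pair; lia].
  by rewrite E eqxx; lia.
move=> a r b s; rewrite mem_box => B /andP[/eqP E o].
have oa : odd a && odd r by nia.
have [c cE] : exists c, 2 * b = a + c by exists (2 * b - a); lia.
have bs : (2 * b) * s = (a + c) * s by rewrite cE.
have ? : 2 * s <= (2 * s) * b by rewrite leq_pmulr; lia.
have ? : 2 * b <= (2 * b) * s by rewrite leq_pmulr; lia.
have ? : r <= a * r by rewrite leq_pmull; lia.
have ? : r + 2 * s <= a * (r + 2 * s) by rewrite leq_pmull; lia.
have ? : a <= a * r by rewrite leq_pmulr; lia.
have -> : 2 * b - a = c by lia.
do 4 eexists; split; [reflexivity | rewrite mem_box; lia | by apply/and5P; split; lia
     | by repeat congr pair; lia].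
Qed.

(** Up to parity the odd [b] give the divisor pairs; the even [b], split by the parity of [s], give
    the two halves of the solutions with coefficient 4. *)
Lemma odd_cnt_gt N : odd N ->
  odd (cnt N (fun a r b s => [&& a * r + b * s == N, odd r & b < a])) =
  odd (cnt N (fun a r b s => [&& a * r == N, a < r, b == 1 & s == 1])
       + cnt N (fun a r b s => a * r + 4 * (b * s) == N)).
Proof.
move=> oddN; rewrite (cnt_split _ (fun a r b s => odd b)).
rewrite [X in _ + X](cnt_split _ (fun a r b s => ~~ odd s)).
rewrite [X in _ = odd (_ + X)](cnt_split _ (fun a r b s => 2 * b < a)).
rewrite !oddD -odd_cnt_gt_odd // -cnt_gt_even_even // -cnt_gt_even_odd //.
by congr (odd _ (+) (odd _ (+) odd _)); apply: eq_cnt => a r b s _ _ _ _;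
  rewrite ?negbK -!andbA.
Qed.

(** Exchanging a divisor with its cofactor has no fixed point. Pinning [b] and [s] to 1 lets [cnt]
    count divisor pairs. *)
Lemma cnt_divisor_pairs N : (forall x, x * x <> N) ->
  cnt N (fun a r b s => [&& a * r == N, b == 1 & s == 1]) =
  2 * cnt N (fun a r b s => [&& a * r == N, a < r, b == 1 & s == 1]).
Proof.
move=> nsq; rewrite (cnt_split _ (fun a r b s => a < r)) mul2n -addnn.
congr (_ + _); first by apply: eq_cnt => a r b s _ _ _ _; lia.
by apply: (cnt_bij _ _ _ (fun '(a, r, b, s) => (r, a, b, s))
                   (fun '(a, r, b, s) => (r, a, b, s))) => a r b s;
  rewrite mem_box => Hb Hp; have := nsq a;
  do 4 eexists; (split; [reflexivity | rewrite mem_box; nia | nia | by []]).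
Qed.

Lemma sum_eq_nat M v (c : bool) :
  \sum_(1 <= b < M.+1) ((b == v) && c) = (0 < v <= M) && c :> nat.
Proof.
elim: M => [|M IH]; first by rewrite big_geq //; lia.
by rewrite big_nat_recr //= IH {IH}; case: c; lia.
Qed.

Lemma sum_odd_lt M v : v <= M ->
  \sum_(1 <= b < M.+1) (odd b && (b < v)) = v./2.
Proof.
elim: v => [|v IH] vM; first by rewrite big1 // => b _; rewrite ltn0 andbF.
have -> : \sum_(1 <= b < M.+1) (odd b && (b < v.+1)) =
  \sum_(1 <= b < M.+1) (odd b && (b < v)) + \sum_(1 <= b < M.+1) ((b == v) && odd v).
  by rewrite -big_split; apply: eq_bigr => b _ /=; case: (ltngtP b v); lia.
by rewrite IH ?sum_eq_nat; lia.
Qed.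

(** For a = b the equation is a(r + s) = N. An odd cofactor c splits as r + s with r odd in (c -
    1)/2 ways, and c is 1 plus twice that number. *)
Lemma sum_divisor_pairs N : odd N ->
  \sum_(1 <= a < N.+1) \sum_(1 <= r < N.+1) r * (a * r == N) =
  cnt N (fun a r b s => [&& a * r == N, b == 1 & s == 1])
  + 2 * cnt N (fun a r b s => [&& a * r + b * s == N, odd r & a == b]).
Proof.
move=> oddN.
have -> : cnt N (fun a r b s => [&& a * r + b * s == N, odd r & a == b]) =
  cnt N (fun a r b s => [&& s == 1, a * r == N, odd b & b < r]).
  by apply: (cnt_bij _ _ _ (fun '(a, r, b, s) => (a, r + s, r, 1))
                     (fun '(a, r, b, s) => (a, b, a, r - b))); quads.
rewrite !cntE big_distrr -big_split; apply: eq_big_nat => a /andP[a0 aN].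
rewrite big_distrr -big_split; apply: eq_big_nat => r /andP[r0 rN] /=.
have sum_s (c : nat -> bool) : \sum_(1 <= b < N.+1) \sum_(1 <= s < N.+1) ((s == 1) && c b) =
    \sum_(1 <= b < N.+1) c b.
  by apply: eq_bigr => b _; rewrite sum_eq_nat; lia.
rewrite (sum_s (fun b => [&& a * r == N, odd b & b < r])).
have -> : \sum_(1 <= b < N.+1) \sum_(1 <= s < N.+1) [&& a * r == N, b == 1 & s == 1] =
    (a * r == N).
  transitivity (\sum_(1 <= b < N.+1) ((b == 1) && (a * r == N)) : nat).
    by rewrite -sum_s; do 2 apply: eq_bigr => ? _; case: eqP; case: eqP; case: eqP.
  by rewrite sum_eq_nat; case: eqP; lia.
case: eqP => [arN|_]; last by rewrite big1 ?muln0.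
have or : odd r by move: oddN; rewrite -arN oddM => /andP[].
rewrite /= sum_odd_lt;lia.
Qed.

(** Let D, L, G count the solutions of ar + bs = N with r odd and a = b, a < b, a > b, and let d
    count the divisor pairs with a < r. Then sigma(N) = 2d + 2D, the sum D + L + G + V is even, and
    G has the parity of d + K; hence sigma(N) + 2L is 2(V + K) modulo 4. The remaining count is
    even. *)
Lemma divisor_sum_mod4 N : odd N -> (forall x, x * x <> N) ->
  \sum_(1 <= a < N.+1) \sum_(1 <= r < N.+1) r * (a * r == N)
  + 2 * (cnt N (fun a r b s => [&& a * r + b * s == N, odd r, odd b & 2 * a < b])
         + cnt N (fun a r b s => [&& a * r + b * s == N, odd r & a < b]))
  = 2 * (cnt N (fun a r b s => a * r + 2 * (b * s) == N)
         + cnt N (fun a r b s => a * r + 4 * (b * s) == N)) %[mod 4].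
Proof.
move=> oddN nsq; rewrite sum_divisor_pairs //.
have := cnt_divisor_pairs _ nsq; have := odd_cnt_gt _ oddN.
have := even_cnt_odd_odd _ oddN; have := cnt_odd_all _ oddN; have := even_cnt_all _ oddN.
have -> : cnt N (fun a r b s => (a * r + b * s == N) && odd r) =
   cnt N (fun a r b s => [&& a * r + b * s == N, odd r & a == b]) +
   (cnt N (fun a r b s => [&& a * r + b * s == N, odd r & a < b]) +
   cnt N (fun a r b s => [&& a * r + b * s == N, odd r & b < a])).
  rewrite (cnt_split _ (fun a r b s => a == b)).
  rewrite [X in _ + X](cnt_split _ (fun a r b s => a < b)) .
  by congr (_ + (_ + _)); apply: eq_cnt => a r b s _ _ _ _; case: eqP; lia.
move: (cnt _ _) (cnt _ _) (cnt _ _) (cnt _ _) (cnt _ _) (cnt _ _) (cnt _ _) (cnt _ _) (cnt _ _).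
lia.
Qed.

(** * Representations by binary quadratic forms *)

(** The condition [C] concerns only the pair left in place, so that this swap and the next one can
    be applied in succession. *)
Lemma odd_cnt_diag_l N k (C : nat -> nat -> bool) :
  odd (cnt N (fun a r b s => (a * r + k * (b * s) == N) && C b s)) =
  odd (cnt N (fun a r b s => [&& a * r + k * (b * s) == N, C b s & a == r])).
Proof.
rewrite (odd_cnt_involution _ _ (fun '(a, r, b, s) => (r, a, b, s))).
  by congr odd; apply: eq_cnt => a r b s _ _ _ _; rewrite -andbA; congr (_ && (_ && _));
    apply/eqP/eqP => [[]|->].
move=> a r b s; rewrite mem_box => ? H; do 4 eexists.
by split; [reflexivity | rewrite mem_box; lia | rewrite [r * a]mulnC |].
Qed.

Lemma odd_cnt_diag_r N k (C : nat -> nat -> bool) :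
  odd (cnt N (fun a r b s => (a * r + k * (b * s) == N) && C a r)) =
  odd (cnt N (fun a r b s => [&& a * r + k * (b * s) == N, C a r & b == s])).
Proof.
rewrite (odd_cnt_involution _ _ (fun '(a, r, b, s) => (a, r, s, b))).
  by congr odd; apply: eq_cnt => a r b s _ _ _ _; rewrite -andbA; congr (_ && (_ && _));
    apply/eqP/eqP => [[]|->].
move=> a r b s; rewrite mem_box => ? H; do 4 eexists.
by split; [reflexivity | rewrite mem_box; lia | rewrite [s * b]mulnC |].
Qed.

Lemma odd_cnt_diag N k :
  odd (cnt N (fun a r b s => a * r + k * (b * s) == N)) =
  odd (cnt N (fun a r b s => [&& a * r + k * (b * s) == N, a == r & b == s])).
Proof.
rewrite -(odd_cnt_diag_r N k (fun a r => a == r)) -(odd_cnt_diag_l N k (fun _ _ => true)).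
by congr odd; apply: eq_cnt => *; rewrite andbT.
Qed.

(** Halving [b = s] multiplies the coefficient by 4; the swap of [b] and [s], read backwards, then
    removes the condition [b == s]. *)
Lemma odd_cnt_diag_half N k : 0 < k ->
  odd (cnt N (fun a r b s =>
     [&& a * r + k * (b * s) == N, ~~ odd b, a == r & b == s])) =
  odd (cnt N (fun a r b s => (a * r + 4 * k * (b * s) == N) && (a == r))).
Proof.
move=> k0.
have -> : cnt N (fun a r b s =>
     [&& a * r + k * (b * s) == N, ~~ odd b, a == r & b == s]) =
  cnt N (fun a r b s => [&& a * r + 4 * k * (b * s) == N, a == r & b == s]).
  apply: (cnt_bij _ _ _ (fun '(a, r, b, s) => (a, r, b./2, s./2))
                      (fun '(a, r, b, s) => (a, r, 2 * b, 2 * s))).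
    move=> a r b s; rewrite mem_box => B /and4P[/eqP E o lt o'].
    have [h hE] : exists h, b = 2 * h by exists b./2; lia.
    have -> : b./2 = h by lia.
    have -> : s./2 = h by lia.
    do 4 eexists; split; [reflexivity | rewrite mem_box; lia | | repeat congr pair; lia].
    have -> : 4 * k * (h * h) = k * (b * s) by rewrite (_ : s = b); lia.
    by rewrite E lt !eqxx.
  move=> a r b s; rewrite mem_box => B /and3P[/eqP E lt o].
  do 4 eexists; split; [reflexivity | rewrite mem_box | | repeat congr pair; lia].
    have ? : 2 * b <= 4 * k * (b * s).
      by rewrite -mulnA leq_mul // mulnCA leq_pmulr //; lia.
    lia.
  have -> : k * (2 * b * (2 * s)) = 4 * k * (b * s) by lia.
  by rewrite E; lia.
by rewrite -(odd_cnt_diag_r _ _ (fun a r => a == r)).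
Qed.

(** Modulo 3 the form is x^2 + y^2, which vanishes only if 3 divides x and y; then 9 divides 3M. *)
Lemma even_cnt_3mul4 M : ~~ (3 %| M) ->
  ~~ odd (cnt (3 * M) (fun a r b s => a * r + 4 * (b * s) == 3 * M)).
Proof.
move=> nM; rewrite odd_cnt_diag cnt0 // => a r b s _; apply/negP.
move=> /and3P[/eqP E /eqP ? /eqP ?]; subst r s.
have [k ka] : exists k, a = 3 * k + a %% 3 by exists (a %/ 3); lia.
have [l lb] : exists l, b = 3 * l + b %% 3 by exists (b %/ 3); lia.
have : a %% 3 < 3 by lia.
have : b %% 3 < 3 by lia.
case: (b %% 3) lb => [|[|[|]]] // lb _; case: (a %% 3) ka => [|[|[|]]] // ka _; subst a b; try lia.
Qed.

(* Multiplication of x + y sqrt(-2) by whichever of (1 - sqrt(-2)) / (1 + sqrt(-2))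
   and its inverse keeps it integral, followed by taking absolute values of the
   coordinates; the representation (x, y) is stored as (x, x, y, y). *)
Definition mul_sqrtm2_unit (t : quad) : quad :=
  let: (a, r, b, s) := t in
  let: (x, y) := if a %% 3 == b %% 3
    then (((a - 4 * b) + (4 * b - a)) %/ 3, (2 * a + b) %/ 3)
    else ((a + 4 * b) %/ 3, ((2 * a - b) + (b - 2 * a)) %/ 3) in
  (x, x, y, y).

(** A fixed point of the map has x = y, making M a square, or x = 2y, making M even. *)
Lemma even_cnt_3mul2 M : odd M -> ~~ (3 %| M) -> (forall x, x * x <> M) ->
  ~~ odd (cnt (3 * M) (fun a r b s => a * r + 2 * (b * s) == 3 * M)).
Proof.
move=> oM nM nsq; rewrite odd_cnt_diag (odd_cnt_involution _ _ mul_sqrtm2_unit).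
  rewrite cnt0 // => a r b s _; apply/negP => /andP[/and3P[/eqP E /eqP ? /eqP ?]].
  subst r s; rewrite /mul_sqrtm2_unit.
  case: (a %% 3 =P b %% 3) => H /= /eqP[H1 _ H2 _].
    have ab : a = b by lia.
    by apply: (nsq a); subst b; lia.
  have ab : a = 2 * b by lia.
  by subst a; lia.
move=> a r b s; rewrite mem_box => B /and3P[/eqP E /eqP ? /eqP ?]; subst r s.
(* If 3 divided both coordinates, 9 would divide 3M. Hence x = y and x = -y modulo 3 exclude each
   other, which decides the branch taken on the way back. *)
have ndiv x y : x * x + 2 * (y * y) = 3 * M -> x %% 3 = 0 -> y %% 3 <> 0.
  move=> xy x0 y0; case/negP: nM; apply/dvdnP.
  have [k kx] : exists k, x = 3 * k by exists (x %/ 3); lia.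
  have [l ly] : exists l, y = 3 * l by exists (y %/ 3); lia.
  by exists (k * k + 2 * (l * l)); subst x y; lia.
(* This excludes a = 4b, where the first coordinate of the image would vanish. *)
have oa : odd a.
  by have := congr1 odd E; rewrite oddD !oddM oM andbb /= addbF.
have close x y : 0 < x -> 0 < y -> x * x + 2 * (y * y) = 3 * M ->
    mul_sqrtm2_unit (a, a, b, b) = (x, x, y, y) ->
    mul_sqrtm2_unit (x, x, y, y) = (a, a, b, b) ->
  exists a' r' b' s', [/\ mul_sqrtm2_unit (a, a, b, b) = (a', r', b', s'),
    (a', r', b', s') \in box (3 * M),
    [&& a' * r' + 2 * (b' * s') == 3 * M, a' == r' & b' == s'] &
    mul_sqrtm2_unit (a', r', b', s') = (a, a, b, b)].
  move=> x0 y0 xy gE gK; exists x, x, y, y; split=> //.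
    have ? : x <= x * x by rewrite leq_pmull.
    have ? : y <= y * y by rewrite leq_pmull.
    by rewrite mem_box; lia.
  by rewrite xy !eqxx.
case: (a %% 3 =P b %% 3) => H.
  have [y yE] : exists y, 2 * a + b = 3 * y by exists ((2 * a + b) %/ 3); lia.
  (* Supplying squares and products of the linear relations makes the norm identity linear in the
     monomials, within reach of [lia]. *)
  have yy := f_equal (fun z => z * z) yE.
  case: (ltnP a (4 * b)) => lt.
    have [x xE] : exists x, 4 * b = a + 3 * x by exists ((4 * b - a) %/ 3); lia.
    have xx := f_equal (fun z => z * z) xE; have ax := f_equal (muln a) xE.
    have xy : x * x + 2 * (y * y) = 3 * M by move: xx ax yy => /=; lia.
    have := ndiv x y xy; clear E xx ax yy => ?.
    apply: (close x y) => //; rewrite /mul_sqrtm2_unit; try case: eqP => ?;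
      repeat congr pair; clear xy; lia.
  have [x xE] : exists x, a = 4 * b + 3 * x by exists ((a - 4 * b) %/ 3); lia.
  have xx := f_equal (fun z => z * z) xE; have bx := f_equal (muln b) xE.
  have xy : x * x + 2 * (y * y) = 3 * M by move: xx bx yy => /=; lia.
  have := ndiv x y xy; clear E xx bx yy => ?.
  apply: (close x y) => //; rewrite /mul_sqrtm2_unit; try case: eqP => ?;
    repeat congr pair; clear xy; lia.
have ab3 : (a + b) %% 3 = 0.
  have [k ka] : exists k, a = 3 * k + a %% 3 by exists (a %/ 3); lia.
  have [l lb] : exists l, b = 3 * l + b %% 3 by exists (b %/ 3); lia.
  have : a %% 3 < 3 by lia.
  have : b %% 3 < 3 by lia.
  by case: (b %% 3) lb H => [|[|[|]]] // lb; case: (a %% 3) ka => [|[|[|]]] // ka _ _ _;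
    subst a b; lia.
have [x xE] : exists x, a + 4 * b = 3 * x by exists ((a + 4 * b) %/ 3); lia.
have xx := f_equal (fun z => z * z) xE.
(* At b = 2a the second coordinate of the image would vanish; there M = 3a^2. *)
have nb : b <> 2 * a.
  by move=> ba; case/negP: nM; apply/dvdnP; exists (a * a); subst b; lia.
case: (ltnP b (2 * a)) => lt.
  have [y yE] : exists y, 2 * a = b + 3 * y by exists ((2 * a - b) %/ 3); lia.
  have yy := f_equal (fun z => z * z) yE; have bY := f_equal (muln b) yE.
  have xy : x * x + 2 * (y * y) = 3 * M by move: xx bY yy => /=; lia.
  have := ndiv x y xy; clear E xx bY yy => ?.
  apply: (close x y) => //; rewrite /mul_sqrtm2_unit; try case: eqP => ?;
    repeat congr pair; clear xy; lia.
have [y yE] : exists y, b = 2 * a + 3 * y by exists ((b - 2 * a) %/ 3); lia.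
have yy := f_equal (fun z => z * z) yE; have aY := f_equal (muln a) yE.
have xy : x * x + 2 * (y * y) = 3 * M by move: xx aY yy => /=; lia.
have := ndiv x y xy; clear E xx aY yy => ?.
apply: (close x y) => //; rewrite /mul_sqrtm2_unit; try case: eqP => ?;
  repeat congr pair; clear xy; lia.
Qed.

(** * Triangular numbers over F_2 *)

Definition triangular (j : nat) : nat := (j * j.+1)./2.

Section Gauss.
Local Open Scope ring_scope.

(* Shanks's finite form of Gauss's product for the triangular numbers. *)
Lemma gauss_triangular (R : comNzRingType) (q : R) n :
  (\prod_(1 <= r < n.+1) (1 - q ^+ (2 * r).-1)) *
    (\sum_(0 <= j < (2 * n).+1) q ^+ triangular j) =
  \sum_(0 <= s < n.+1) (\prod_(1 <= r < s.+1) (1 - q ^+ (2 * r).-1)) *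
    (\prod_(s.+1 <= r < n.+1) (1 - q ^+ (2 * r))) * q ^+ (s * (2 * n).+1).
Proof.
pose D k := \prod_(1 <= r < k.+1) (1 - q ^+ (2 * r).-1).
elim: n => [|n IH]; first by rewrite muln0 !big_nat1 !big_geq //= !mul1r.
have DS k : D k.+1 = D k * (1 - q ^+ (2 * k).+1).
  by rewrite /D big_nat_recr //; congr (_ * (1 - q ^+ _)); lia.
have To : triangular (2 * n).+1 = (n.+1 * (2 * n).+1)%N.
  by rewrite /triangular -[RHS]doubleK; congr _./2; lia.
have Te : triangular (2 * n).+2 = (n.+1 * (2 * n).+3)%N.
  by rewrite /triangular -[RHS]doubleK; congr _./2; lia.
rewrite -/(D n.+1) DS [RHS]big_nat_recr // [X in _ = _ + _ * X * _]big_geq // mulr1.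
have -> : (2 * n.+1)%N = (2 * n).+2 by lia.
rewrite [X in _ * X = _]big_nat_recr // [X in _ * (X + _) = _]big_nat_recr // To Te -/(D n.+1) DS.
rewrite mulrDr mulrDr [X in X + _ + _]mulrAC IH.
congr (_ + _).
(* Starting the product at r = s makes [u 0] vanish through the factor 1 - q^0, while [u n.+1] is
   the term of the triangular number of index 2n + 1. After telescoping, the identity holds for each
   s separately. *)
pose u s := D s * (\prod_(s <= r < n.+1) (1 - q ^+ (2 * r))) * q ^+ (s * (2 * n).+1).
have -> : D n * (1 - q ^+ (2 * n).+1) * q ^+ (n.+1 * (2 * n).+1) = u n.+1 - u 0%N.
  rewrite /u big_geq // mulr1 [\prod_(0 <= r < _) _]big_ltn // expr0 subrr mul0r mulr0 mul0r subr0.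
  by rewrite DS.
rewrite -(telescope_sumr u) // mulr_suml -big_split.
apply: eq_big_nat => s /andP[_ sn] /=.
rewrite /u [\prod_(s.+1 <= r < n.+2) _]big_nat_recr //= [\prod_(s <= r < n.+1) _]big_ltn //.
rewrite DS -/(D s); move: (D s) (\prod_(_ <= _ < _) _) => x y.
have -> : (s * (2 * n).+3 = s * (2 * n).+1 + 2 * s)%N by lia.
have -> : (s.+1 * (2 * n).+1 = s * (2 * n).+1 + (2 * n).+1)%N by lia.
have -> : (2 * n.+1 = (2 * n).+2)%N by lia.
rewrite (exprD q _ (2 * s)) (exprD q _ (2 * n).+1) !(exprS q (2 * n).+1).
by rewrite (exprS q (2 * s)) (exprS q (2 * n)); ring.
Qed.

Local Notation F2X := {poly 'F_2}.

Lemma natF2 k : k%:R = (odd k)%:R :> 'F_2.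
Proof. by apply/val_inj; rewrite /= !val_Fp_nat //= modn2; case: odd. Qed.

Lemma even_natF2 k : k%:R = 0 :> 'F_2 -> ~~ odd k.
Proof. by rewrite natF2; case: odd. Qed.

Lemma natF2X k : k%:R = (odd k)%:R :> F2X.
Proof. by rewrite -!polyC_natr natF2. Qed.

(** In characteristic 2 a monomial of even degree has zero derivative. *)
Lemma deriv_prod_even n : (\prod_(1 <= r < n.+1) (1 - 'X ^+ (2 * r)))^`() = 0 :> F2X.
Proof.
elim: n => [|n IH]; first by rewrite big_geq // derivC.
rewrite big_nat_recr //= derivM IH mul0r add0r derivB derivC derivXn -mulr_natr.
by rewrite natF2X oddM mulr0 subr0 mulr0.
Qed.

(* Over F_2, 'X times the logarithmic derivative of [odd_prod n] modulo 'X^K. *)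
Definition odd_lambert K n : F2X :=
  \sum_(1 <= r < n.+1) \sum_(1 <= e < K.+1) 'X ^+ ((2 * r).-1 * e).

Definition odd_prod n : F2X := \prod_(1 <= r < n.+1) (1 - 'X ^+ (2 * r).-1).

(** For odd i, X times the derivative of 1 - X^i is -X^i over F_2, and 1 - X^i times its truncated
    geometric series is X^i - X^(i(K + 1)); only multiples of X^K survive. *)
Lemma deriv_odd_prod K n :
  'X ^+ K %| 'X * (odd_prod n)^`() + odd_prod n * odd_lambert K n.
Proof.
elim: n => [|n].
  by rewrite /odd_prod /odd_lambert !big_geq // derivC !mulr0 addr0 dvdp0.
have -> : odd_prod n.+1 = odd_prod n * (1 - 'X ^+ (2 * n).+1).
  by rewrite /odd_prod big_nat_recr //; congr (_ * (1 - _ ^+ _)); lia.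
pose g : F2X := \sum_(1 <= e < K.+1) 'X ^+ ((2 * n).+1 * e).
have -> : odd_lambert K n.+1 = odd_lambert K n + g.
  rewrite /odd_lambert big_nat_recr //; congr (_ + _); apply: eq_bigr => e _.
  by congr (_ ^+ (_ * _)); lia.
have gE : (1 - 'X ^+ (2 * n).+1) * g = 'X ^+ (2 * n).+1 - 'X ^+ ((2 * n).+1 * K.+1).
  rewrite /g; elim: (K) => [|k IH]; first by rewrite big_geq // mulr0 muln1 subrr.
  rewrite big_nat_recr // mulrDr IH [((2 * n).+1 * k.+2)%N]mulnS exprD; ring.
rewrite derivM derivB derivC derivXn sub0r -mulr_natr natF2X /=.
move: (odd_prod n) (odd_lambert K n) => D L /dvdpP[q IH].
have -> : 'X * (D^`() * (1 - 'X ^+ (2 * n).+1) + D * - ('X ^+ (2 * n) * (odd (2 * n).+1)%:R))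
   + D * (1 - 'X ^+ (2 * n).+1) * (L + g)
  = ('X * D^`() + D * L) * (1 - 'X ^+ (2 * n).+1)
   + D * ((1 - 'X ^+ (2 * n).+1) * g - 'X ^+ (2 * n).+1).
  rewrite oddS oddM /= (exprS 'X (2 * n)); ring.
rewrite IH gE dvdp_add //; first by rewrite -mulrA [_ ^+ K * _]mulrC mulrA dvdp_mull.
rewrite dvdp_mull // addrC addKr dvdpNr dvdp_exp2l //.
by apply: leq_trans (leq_pmull _ _); lia.
Qed.

Definition triangular_sum n : F2X := \sum_(0 <= j < (2 * n).+1) 'X ^+ triangular j.

(** After multiplication by [odd_prod n], which is prime to X, Gauss's identity applies: modulo X^K
    the product with psi is that of the 1 - X^(2r), whose derivative is zero. The Leibniz rule and
    [deriv_odd_prod] conclude. *)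
Lemma deriv_triangular_dvd n :
  'X ^+ (2 * n).+1 %|
    'X * (triangular_sum n)^`() - triangular_sum n * odd_lambert (2 * n).+1 n.
Proof.
set K := (2 * n).+1; set psi := triangular_sum n.
have [W DW] : exists W, odd_prod n * psi =
    (\prod_(1 <= r < n.+1) (1 - 'X ^+ (2 * r))) + 'X ^+ K * W.
  have /dvdpP[W SW] : 'X ^+ K %| (\sum_(1 <= s < n.+1)
      (\prod_(1 <= r < s.+1) (1 - 'X ^+ (2 * r).-1)) *
      (\prod_(s.+1 <= r < n.+1) (1 - 'X ^+ (2 * r))) * 'X ^+ (s * K) : F2X).
    rewrite big_nat_cond; apply: (big_ind (fun p : F2X => 'X ^+ K %| p)) => [|p r|s].
    - exact: dvdp0.
    - exact: dvdp_add.
    - by case/andP=> [/andP[s0 _] _]; rewrite dvdp_mull // dvdp_exp2l // leq_pmull.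
  exists W; rewrite /odd_prod /psi /triangular_sum gauss_triangular.
  rewrite [LHS]big_ltn // SW [X in X * _ * _]big_geq //.
  by rewrite mul1r mul0n expr0 mulr1 [W * _]mulrC.
have cop : coprimep ('X ^+ K) (odd_prod n).
  rewrite coprimep_expl // /odd_prod big_nat_cond.
  apply: (big_ind (coprimep 'X)) => [|p r|r].
  - exact: coprimep1.
  - by rewrite coprimepMr => -> ->.
  - case/andP=> /andP[r0 _] _; rewrite -['X]subr0 coprimep_sym coprimep_XsubC.
    by rewrite rootE !hornerE oppr0 expr0n; case: r r0 => // r _; rewrite mulnS subr0 oner_neq0.
rewrite -(Gauss_dvdpr _ cop).
have [V DV] := dvdpP _ _ (deriv_odd_prod K n).
have -> : odd_prod n * ('X * psi^`() - psi * odd_lambert K n) =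
  'X * (odd_prod n * psi)^`() - psi * ('X * (odd_prod n)^`() + odd_prod n * odd_lambert K n).
  rewrite derivM; ring.
rewrite DV DW derivD deriv_prod_even add0r derivM derivXn.
apply: dvdp_sub; last by rewrite !dvdp_mull.
rewrite mulrDr; apply: dvdp_add; last by rewrite mulrCA dvdp_mulr.
(* The factor ['X] restores the power lost in differentiating ['X ^+ K]. *)
by rewrite mulrA mulrnAr -exprS -mulr_natr !dvdp_mulr.
Qed.

(** Over F_2 the sum is the coefficient of X^m in psi times the Lambert sum, hence in X psi', and
    psi has no term X^m. *)
Lemma even_triangular_count m n : (m <= 2 * n)%N -> (forall j, triangular j <> m) ->
  ~~ odd (\sum_(0 <= j < (2 * n).+1) \sum_(1 <= r < n.+1) \sum_(1 <= e < (2 * n).+2)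
            (triangular j + (2 * r).-1 * e == m)%N).
Proof.
move=> mn ntri; apply: even_natF2.
have /dvdpP[W /(congr1 (fun p : F2X => p`_m))] := deriv_triangular_dvd n.
rewrite coefB coefMXn ltnS mn coefXM coef_deriv.
have -> : (if m == 0%N then 0 else (triangular_sum n)`_m.-1.+1 *+ m.-1.+1) = 0.
  case: m ntri {mn W} => //= m ntri.
  rewrite /triangular_sum coef_sum big1 ?mul0rn // => j _.
  by rewrite coefXn; case: eqP => // E; case: (ntri j).
rewrite sub0r => /eqP; rewrite oppr_eq0 => /eqP <-.
rewrite /triangular_sum mulr_suml coef_sum natr_sum; apply: eq_bigr => j _.
rewrite /odd_lambert mulr_sumr coef_sum natr_sum; apply: eq_bigr => r _.
rewrite mulr_sumr coef_sum natr_sum; apply: eq_bigr => e _.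
by rewrite -exprD coefXn eq_sym.
Qed.
End Gauss.


(** * Odd squares and triangular numbers *)

Lemma triangularE j : 8 * triangular j + 1 = (2 * j).+1 * (2 * j).+1.
Proof.
have : (triangular j).*2 = j * j.+1.
  by rewrite /triangular even_halfK // oddM /= andbN.
lia.
Qed.

(** Put a = 2j + 1 and b = 2k + 1. As a^2 = 8T + 1 with T the triangular number of index j, the
    equation becomes T + (2k + 1)s = m. *)
Lemma even_cnt_square_8mul m : let N := (8 * m).+1 in (forall x, x * x <> N) ->
  ~~ odd (cnt N (fun a r b s => [&& a * r + 8 * (b * s) == N, odd b & a == r])).
Proof.
move=> N nsq.
have ntri j : triangular j <> m.
  by move=> jm; case: (nsq (2 * j).+1); rewrite -triangularE jm /N; lia.
have -> : cnt N (fun a r b s => [&& a * r + 8 * (b * s) == N, odd b & a == r]) =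
  cnt N (fun a r b s => (b == 1) && (triangular a.-1 + (2 * r).-1 * s == m)).
  (* Box coordinates start at 1, so j and k are stored as j + 1 and k + 1; the freed coordinate is
     set to 1. *)
  apply: (cnt_bij _ _ _ (fun '(a, r, b, s) => (a.+1./2, b.+1./2, 1, s))
                        (fun '(a, r, b, s) => ((2 * a).-1, (2 * a).-1, (2 * r).-1, s))).
    move=> a r b s; rewrite mem_box => B /and3P[/eqP E ob /eqP ar]; subst r.
    have oa : odd a.
      by have := congr1 odd E; rewrite oddD !oddM andbb addbF => ->; rewrite /N /= oddM.
    have [j jE] : exists j, a = (2 * j).+1 by exists a./2; lia.
    have [k kE] : exists k, b = (2 * k).+1 by exists b./2; lia.
    have -> : a.+1./2 = j.+1 by lia.
    have -> : b.+1./2 = k.+1 by lia.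
    have T := triangularE j.
    do 4 eexists; split; [reflexivity | rewrite mem_box; lia | | repeat congr pair; lia].
    have -> : (2 * k.+1).-1 = b by lia.
    by rewrite eqxx /=; subst a; apply/eqP; rewrite /N in E; lia.
  move=> a r b s; rewrite mem_box => B /andP[/eqP b1 /eqP E]; subst b.
  have [j jE] : exists j, a = j.+1 by exists a.-1; lia.
  have [k kE] : exists k, r = k.+1 by exists r.-1; lia.
  have T := triangularE j; subst a r; rewrite /= in E.
  have -> : (2 * j.+1).-1 = (2 * j).+1 by lia.
  have kE : (2 * k.+1).-1 = (2 * k).+1 by lia.
  rewrite kE in E *.
  have ? : (2 * k).+1 <= (2 * k).+1 * s by rewrite leq_pmulr; lia.
  have ? : (2 * j).+1 <= (2 * j).+1 * (2 * j).+1 by rewrite leq_pmulr; lia.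
  do 4 eexists; split; [reflexivity | rewrite mem_box; lia | | repeat congr pair; lia].
  by rewrite -T; apply/and3P; split; lia.
(* The choice n = 4m makes 2n + 1 equal to N; the indices r > 4m contribute nothing since 2r - 1 >
   m. *)
have -> : cnt N (fun a r b s => (b == 1) && (triangular a.-1 + (2 * r).-1 * s == m)) =
   \sum_(0 <= j < (2 * (4 * m)).+1) \sum_(1 <= r < (4 * m).+1)
     \sum_(1 <= e < (2 * (4 * m)).+2) (triangular j + (2 * r).-1 * e == m).
  rewrite cntE big_add1 /= (_ : N = (2 * (4 * m)).+1); last by rewrite /N; lia.
  apply: eq_big_nat => j _.
  have collapse r : \sum_(1 <= b < (2 * (4 * m)).+2) \sum_(1 <= s < (2 * (4 * m)).+2)
      ((b == 1) && (triangular j + (2 * r).-1 * s == m)) =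
      \sum_(1 <= e < (2 * (4 * m)).+2) (triangular j + (2 * r).-1 * e == m).
    by rewrite exchange_big; apply: eq_bigr => e _; rewrite sum_eq_nat; lia.
  rewrite (eq_bigr _ (fun r _ => collapse r)) (@big_cat_nat _ _ _ (4 * m).+1) //=; last by lia.
  rewrite [X in _ + X]big1_seq ?addn0 // => r; rewrite mem_index_iota => /andP[_ rm].
  rewrite big1_seq // => e; rewrite mem_index_iota => /andP[_ em].
  case: eqP => // E; suff : m < (2 * r).-1 * e by lia.
  by apply: leq_trans (leq_pmulr _ _); lia.
by apply: even_triangular_count; first lia.
Qed.

(** Odd squares are 1 modulo 8, so y is even in both forms. Halving y and undoing the swap of b and
    s leads to a^2 + 8bs and a^2 + 16bs; the solutions of the former with b even cancel the
    latter. *)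
Lemma even_cnt_1mod8 N : N %% 8 = 1 -> (forall x, x * x <> N) ->
  ~~ odd (cnt N (fun a r b s => a * r + 2 * (b * s) == N)
        + cnt N (fun a r b s => a * r + 4 * (b * s) == N)).
Proof.
move=> N8 nsq; rewrite oddD !odd_cnt_diag.
have sq8 x : odd x -> (x * x) %% 8 = 1.
  move=> ox; have [h ->] : exists h, x = (2 * h).+1 by exists x./2; lia.
  by rewrite -triangularE; lia.
have even_b k : (k == 2) || (k == 4) ->
  cnt N (fun a r b s => [&& a * r + k * (b * s) == N, a == r & b == s]) =
  cnt N (fun a r b s => [&& a * r + k * (b * s) == N, ~~ odd b, a == r & b == s]).
  move=> k24; apply: eq_cnt => a r b s _ _ _ _.
  apply/and3P/and4P => [] []; last by move=> E _ ar bs; split.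
  move=> E ar bs; split=> //; move/eqP: E; rewrite -(eqP ar) -(eqP bs) => E.
  apply/negP=> /sq8 b8.
  have oa : odd a.
    have := congr1 odd E; rewrite oddD !oddM andbb; case/orP: k24 => /eqP -> /=; lia.
  have := sq8 _ oa; case/orP: k24 E => /eqP -> E; lia.
rewrite !even_b // !odd_cnt_diag_half //= -oddD.
have N8E : N = (8 * (N %/ 8)).+1 by lia.
rewrite (cnt_split _ (fun a r b s => odd b) (fun a r b s => _ && (a == r))).
have := even_cnt_square_8mul (N %/ 8); rewrite -N8E => /(_ nsq).
set x := cnt _ _; set y := cnt _ _; set z := cnt _ _; set t := cnt _ _ => xe.
have -> : y = x by apply: eq_cnt => a r b s _ _ _ _; rewrite -andbA [_ && odd b]andbC.
suff -> : z = t by rewrite -addnA addnn oddD odd_double addbF.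
apply: (cnt_bij _ _ _ (fun '(a, r, b, s) => (a, r, b./2, s))
                      (fun '(a, r, b, s) => (a, r, 2 * b, s))).
  move=> a r b s; rewrite mem_box => B /andP[/andP[E ar] ob].
  have [h hE] : exists h, b = 2 * h by exists b./2; lia.
  have -> : b./2 = h by lia.
  do 4 eexists; split; [reflexivity | rewrite mem_box; lia | | repeat congr pair; lia].
  by rewrite ar andbT -(eqP E) hE; apply/eqP; lia.
move=> a r b s; rewrite mem_box => B /andP[/eqP E ar].
have ? : b <= b * s by rewrite leq_pmulr; lia.
do 4 eexists; split; [reflexivity | rewrite mem_box; lia | | repeat congr pair; lia].
by rewrite ar andbT oddM /= andbT; apply/eqP; lia.
Qed.

(** * Overpartitions modulo 4 *)

Definition block (m k : nat) (b : bool) : marked_seq := (m, b) :: nseq k.-1 (m, false).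
(** The pairwise form, shared with [overlined_first_only], splits over concatenation. *)
Definition nonincreasing (s : marked_seq) : bool :=
  pairwise (fun x y : nat * bool => y.1 <= x.1) s.

Lemma sorted_parts s : sorted geq (parts s) = nonincreasing s.
Proof.
rewrite sorted_pairwise ?pairwise_map // => y x z /= yx zy.
exact: leq_trans zy yx.
Qed.

Lemma nonincreasing_split t s : nonincreasing s ->
  s = [seq x <- s | t <= x.1] ++ [seq x <- s | x.1 < t].
Proof.
elim: s => //= x s IH /andP[xs /IH {}IH].
case: (leqP t x.1) => xt /=; first by rewrite -IH.
have lt : all (fun y => y.1 < t) s.
  by apply: sub_all xs => y yx; apply: leq_ltn_trans yx xt.
rewrite (@eq_in_filter _ (fun y => t <= y.1) pred0) ?filter_pred0.
  by rewrite (all_filterP lt).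
by move=> y /(allP lt) /=; lia.
Qed.

Lemma nonincreasing_const m s : all (fun x => x.1 == m) s -> nonincreasing s.
Proof.
elim: s => //= x s IH /andP[/eqP xm sm]; rewrite -/(nonincreasing s) IH // andbT.
by apply: sub_all sm => y /eqP ->; rewrite xm.
Qed.

(** Entries on different sides of the threshold are strictly ordered, so every condition across the
    cut holds. *)
Lemma cat_overpartition (s1 s2 : marked_seq) t :
  all (fun x => t <= x.1) s1 -> all (fun x => x.1 < t) s2 ->
  nonincreasing (s1 ++ s2) && overlined_first_only (s1 ++ s2) =
  [&& nonincreasing s1, overlined_first_only s1, nonincreasing s2 &
      overlined_first_only s2].
Proof.
move=> s1t s2t; rewrite /nonincreasing /overlined_first_only !pairwise_cat.
have -> : allrel (fun x y : nat * bool => y.1 <= x.1) s1 s2.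
  by apply/allrelP => x y /(allP s1t) /= tx /(allP s2t) /= yt; lia.
have -> : allrel (fun x y : nat * bool => y.2 ==> (x.1 != y.1)) s1 s2.
  by apply/allrelP => x y /(allP s1t) /= tx /(allP s2t) /= yt; lia.
by rewrite /= -!andbA; do !bool_congr; rewrite andbCA.
Qed.

Lemma block_overpartition m k b :
  nonincreasing (block m k b) && overlined_first_only (block m k b).
Proof.
rewrite /block (nonincreasing_const m) /=; last by rewrite eqxx all_nseq eqxx orbT.
rewrite /overlined_first_only /= all_nseq /= orbT /=.
by elim: k.-1 => //= j ->; rewrite all_nseq orbT.
Qed.

Lemma blockP m s : all (fun x => x.1 == m) s -> overlined_first_only s -> 0 < size s ->
  exists b, s = block m (size s) b.
Proof.
case: s => //= -[m' b] s /andP[/eqP /= -> sm] /andP[sb _] _; exists b.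
rewrite /block /=; congr cons; apply/all_pred1P/allP => -[y c] ys.
move: (allP sm _ ys) (allP sb _ ys) => /= /eqP ->.
by rewrite eqxx implybF; case: c {ys}.
Qed.

Definition marks_mults (m x : nat) : seq (bool * nat) :=
  [seq (b, k) | b <- [:: false; true], k <- [seq k <- iota 1 x | k * m <= x]].
Arguments marks_mults : simpl never.

Lemma mem_marks_mults m x b k :
  ((b, k) \in marks_mults m x) = [&& k * m <= x & 0 < k <= x].
Proof.
apply/allpairsP/idP => [[[b' k'] /= [_ kin [_ ->]]]|kin].
  by move: kin; rewrite mem_filter mem_iota add1n ltnS.
exists (b, k); rewrite /= mem_filter mem_iota add1n ltnS kin; split=> //.
by case: b.
Qed.

Lemma marks_mults_uniq m x : uniq (marks_mults m x).
Proof.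
by apply: allpairs_uniq => [||[? ?] [? ?]]; rewrite ?filter_uniq ?iota_uniq.
Qed.

(* All overpartitions of x with parts in the interval ]a, a + d]. *)
Fixpoint overpartitions (a d x : nat) : seq marked_seq :=
  if d is d'.+1 then
    overpartitions a d' x ++
    [seq block (a + d) p.2 p.1 ++ s |
       p <- marks_mults (a + d) x,
       s <- overpartitions a d' (x - p.2 * (a + d))]
  else if x == 0 then [:: [::]] else [::].

Definition overpartition_in (a d x : nat) (s : marked_seq) : bool :=
  [&& nonincreasing s && overlined_first_only s, all (fun y => a < y.1 <= a + d) s
    & sumn (parts s) == x].

Lemma sumn_block m k b : 0 < k -> sumn (parts (block m k b)) = k * m.
Proof. by case: k => //= k _; rewrite /block /parts /unzip1 map_nseq sumn_nseq mulSn mulnC. Qed.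

(** Cut at the largest admissible part: the upper piece is empty or, by [blockP], a single block;
    induction handles the lower piece. *)
Lemma mem_overpartitions a d x s :
  (s \in overpartitions a d x) = overpartition_in a d x s.
Proof.
elim: d x s => [|d IH] x s /=.
  rewrite /overpartition_in addn0; case: s => [|y s] /=.
    by rewrite eq_sym; case: (0 == x).
  have -> : (a < y.1 <= a) = false by lia.
  by rewrite /= andbF; case: (x == 0).
rewrite mem_cat IH; apply/orP/idP => [[]|].
- case/and3P=> H1 H2 H3; apply/and3P; split=> //.
  by apply: sub_all H2 => y; lia.
- case/allpairsPdep => -[b k] [s' [/= bk]]; rewrite mem_marks_mults in bk.
  rewrite IH => /and3P[H1 H2 /eqP H3] -> .
  rewrite -[_ :: _]/(block (a + d.+1) k b ++ s').
  have k0 : 0 < k by case/and3P: bk.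
  apply/and3P; split.
  + rewrite (@cat_overpartition _ _ (a + d.+1)).
    * by rewrite andbA block_overpartition.
    * by rewrite /block /= leqnn all_nseq leqnn orbT.
    * by apply: sub_all H2 => y; lia.
  + rewrite all_cat /block /= all_nseq /= addnS ltnS leq_addr leqnn orbT /=.
    by apply: sub_all H2 => y; lia.
  + rewrite /parts /unzip1 map_cat sumn_cat -/unzip1 -/(parts _) -/(parts s') H3.
    by rewrite sumn_block //; apply/eqP; case/and3P: bk => *; lia.
case/and3P=> nn all_s /eqP sum_s; have /andP[ni _] := nn.
set m := a + d.+1.
have sE := nonincreasing_split m s ni.
set u := [seq x <- s | m <= x.1] in sE; set v := [seq x <- s | x.1 < m] in sE.
have um : all (fun x => m <= x.1) u by apply/allP => y; rewrite mem_filter => /andP[].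
have vm : all (fun x => x.1 < m) v by apply/allP => y; rewrite mem_filter => /andP[].
move: nn; rewrite {1 2}sE.
rewrite (@cat_overpartition _ _ m) // => /and4P[niu ofou niv ofov].
have v_in : all (fun y => a < y.1 <= a + d) v.
  apply/allP => y yv; have ym := allP vm _ yv.
  move: yv ym; rewrite mem_filter => /andP[_ /(allP all_s)] /= /andP[-> _].
  by rewrite /m addnS ltnS.
have u_in : all (fun y => y.1 == m) u.
  apply/allP => y yu; have ym := allP um _ yu; apply/eqP.
  move: yu ym; rewrite mem_filter => /andP[_ /(allP all_s)] /= /andP[_ ym] my.
  by apply/eqP; rewrite eqn_leq my ym.
have sum_uv : sumn (parts u) + sumn (parts v) = x.
  by rewrite -sum_s [in RHS]sE /parts /unzip1 map_cat sumn_cat.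
have [u0|u0] := posnP (size u).
  left; rewrite sE (size0nil u0) /=; apply/and3P; split=> //; first by rewrite niv.
  by rewrite -sum_uv (size0nil u0).
right; have [b uE] := blockP m u u_in ofou u0.
rewrite uE sumn_block // in sum_uv.
have km : size u <= size u * m by rewrite leq_pmulr // /m addnS.
apply/allpairsPdep; exists (b, size u), v; split=> /=.
- by rewrite mem_marks_mults u0 -sum_uv leq_addr (leq_trans km) ?leq_addr.
- by rewrite IH /overpartition_in niv ofov v_in -sum_uv addKn eqxx.
- by rewrite -/m {1}sE {1}uE.
Qed.

(** The number of entries with part a + d + 1 tells the two sublists apart and determines the
    multiplicity in the block. *)
Lemma overpartitions_uniq a d x : uniq (overpartitions a d x).
Proof.
elim: d x => [|d IH] x; first by rewrite /=; case: eqP.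
have small m s y : s \in overpartitions a d y -> m = a + d.+1 -> count (fun z => z.1 == m) s = 0.
  rewrite mem_overpartitions => /and3P[_ /allP sd _] ->; apply/eqP.
  by rewrite -leqn0 leqNgt -has_count; apply/hasP => -[z /sd /= zd /eqP zm]; lia.
rewrite [overpartitions _ _ _]/= cat_uniq IH andTb; apply/andP; split.
  apply/hasPn => s' /allpairsPdep[p [s [_ _ ->]]]; apply/negP => /small /(_ erefl).
  by rewrite /= eqxx.
apply: allpairs_uniq_dep => //.
- exact: marks_mults_uniq.
- move=> [[b k] s] [[b' k'] s'] /allpairsPdep[p [t [pin tin E]]].
  case/allpairsPdep=> p' [t' [pin' tin' E']].
  have pE : (b, k) = p := congr1 tag E.
  have sE : s = t := congr1 (fun z : {_ & _} => (tagged z : marked_seq)) E.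
  have pE' : (b', k') = p' := congr1 tag E'.
  have sE' : s' = t' := congr1 (fun z : {_ & _} => (tagged z : marked_seq)) E'.
  subst p t p' t' => /= -[bb' ss'].
  move: pin pin'; rewrite !mem_marks_mults => /and3P[_ k0 _] /and3P[_ k0' _].
  have kk' : k = k'.
    move: (congr1 (count (fun z => z.1 == a + d.+1)) ss').
    rewrite !count_cat !count_nseq (small _ _ _ tin) // (small _ _ _ tin') //=.
    by rewrite eqxx; lia.
  subst k' b'; congr existT; apply/eqP.
  by move/eqP: ss'; rewrite eqseq_cat // eqxx.
Qed.

Lemma size_overpartitionsS a d x :
  size (overpartitions a d.+1 x) = size (overpartitions a d x)
  + 2 * \sum_(1 <= k < x.+1 | k * (a + d.+1) <= x) size (overpartitions a d (x - k * (a + d.+1))).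
Proof.
rewrite [overpartitions _ _ _]/= size_cat size_allpairs_dep; congr (_ + _).
rewrite /marks_mults sumnE big_map /= cats0 big_cat /= !big_map.
by rewrite big_filter /index_iota subSS subn0 mul2n addnn.
Qed.

Lemma odd_size_overpartitions a d x : odd (size (overpartitions a d x)) = (x == 0).
Proof.
elim: d => [|d IH] in x *; first by rewrite /=; case: eqP.
by rewrite size_overpartitionsS oddD IH oddM addbF.
Qed.

Lemma sum_nat_extend M B (F : nat -> nat) : M <= B ->
  (forall i, 0 < i -> M < i -> F i = 0) ->
  \sum_(1 <= i < M.+1) F i = \sum_(1 <= i < B.+1) F i.
Proof.
move=> MB F0; rewrite [RHS](@big_cat_nat _ _ _ M.+1) //=.
rewrite [X in _ = _ + X]big1_seq ?addn0 // => i.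
by rewrite mem_index_iota => /and3P[_ Mi _]; apply: F0 => //; apply: leq_ltn_trans Mi.
Qed.

(* Every part size beyond the first contributes a factor 2, for its mark. *)
Lemma size_overpartitions_mod4 B a d x : a + d <= B -> x <= B ->
  size (overpartitions a d x) =
    (x == 0) + 2 * \sum_(1 <= j < B.+1) \sum_(1 <= k < B.+1)
                     ((a < j <= a + d) && (j * k == x)) %[mod 4].
Proof.
move=> adB xB; elim: d adB => [|d IH] adB.
  by rewrite /= big1 => [|j _]; [case: eqP|rewrite big1 // => k _; lia].
rewrite size_overpartitionsS -modnDml {}IH ?modnDml; last by lia.
have -> : \sum_(1 <= j < B.+1) \sum_(1 <= k < B.+1) ((a < j <= a + d.+1) && (j * k == x)) =
  \sum_(1 <= j < B.+1) \sum_(1 <= k < B.+1) ((a < j <= a + d) && (j * k == x)) +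
  \sum_(1 <= k < B.+1) ((a + d.+1) * k == x).
  transitivity (\sum_(1 <= j < B.+1) \sum_(1 <= k < B.+1)
    (((a < j <= a + d) && (j * k == x)) + ((j == a + d.+1) && ((a + d.+1) * k == x)))).
    do 2 (apply: eq_bigr => ? _); case: (eqVneq _ (a + d.+1)) => [->|]; lia.
  under eq_bigr do rewrite big_split.
  rewrite big_split [X in _ + X = _]exchange_big; congr (_ + _); apply: eq_bigr => k _ /=.
  by rewrite sum_eq_nat; lia.
rewrite mulnDr addnA; apply/eqP; rewrite eqn_modDl; apply/eqP.
set s1 := \sum_(_ <= _ < _ | _) _; set s2 := \sum_(_ <= _ < _) _.
(* Under the factor 2 only parities matter, and by [odd_size_overpartitions] only a block that
   exhausts [x] contributes. *)
suff : odd s1 = odd s2 by lia.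
rewrite /s2 -(sum_nat_extend x) => // [|k k0 xk]; last first.
  by case: eqP => // E; suff : k <= (a + d.+1) * k; [lia | rewrite leq_pmull // addnS].
rewrite /s1 big_mkcond !(big_morph odd oddD (erefl _)); apply: eq_big_nat => k /andP[k0 kx].
case: leqP => kd; rewrite ?odd_size_overpartitions; lia.
Qed.

(** * Splitting off the smallest part *)

Definition smallest_blocks n : seq (nat * nat) :=
  [seq p <- [seq (a, r) | a <- iota 1 n, r <- iota 1 n] | ~~ odd p.1 && (p.1 * p.2 <= n)].

Lemma mem_smallest_blocks n a r :
  ((a, r) \in smallest_blocks n) =
  [&& ~~ odd a, a * r <= n, 0 < a <= n & 0 < r <= n].
Proof.
rewrite mem_filter /= -!andbA; do 2 bool_congr.
apply/allpairsP/idP => [[[a' r'] /= [ain rin [-> ->]]]|H].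
  by move: ain rin; rewrite !mem_iota; lia.
by exists (a, r); split=> /=; rewrite ?mem_iota //; lia.
Qed.

(** The interval ]a, a + n] is wide enough for the parts above the smallest part a, since no part
    exceeds n. *)
Definition spt2_overpartitions n : seq marked_seq :=
  [seq s ++ nseq p.2 (p.1, false) |
    p <- smallest_blocks n, s <- overpartitions p.1 n (n - p.1 * p.2)].

Lemma last_parts_nseq s a r : 0 < r -> smallest_part (s ++ nseq r (a, false)) = a.
Proof.
case: r => // r _; rewrite /smallest_part /parts /unzip1 map_cat last_cat map_nseq /=.
by elim: r.
Qed.

Lemma size_leq_sumn p : all (fun m => 0 < m) p -> size p <= sumn p.
Proof. by elim: p => //= m p IH /andP[m0 /IH]; lia. Qed.

Lemma leq_sumn m p : m \in p -> m <= sumn p.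
Proof. by elim: p => //= x p IH; rewrite inE => /orP[/eqP ->|/IH]; lia. Qed.

(** At n = 0 the empty sequence would pass the right-hand test through the default value of [last],
    whereas there is no smallest block. *)
Lemma mem_spt2_overpartitions n s : 0 < n ->
  (s \in spt2_overpartitions n) =
  is_overpartition n s && smallest_even_nonoverlined s.
Proof.
move=> n0; rewrite /is_overpartition /is_partition sorted_parts.
apply/allpairsPdep/idP.
  case=> -[a r] [s' [/=]]; rewrite mem_smallest_blocks mem_overpartitions => ar.
  case/and3P=> novl s'a /eqP sum_s' ->.
  have r0 : 0 < r by lia.
  rewrite /smallest_even_nonoverlined last_parts_nseq // mem_cat mem_nseq negb_or.
  have s'a' : all (fun x => a.+1 <= x.1) s' by apply: sub_all s'a => y /andP[].
  have ra : all (fun x : nat * bool => x.1 < a.+1) (nseq r (a, false)).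
    by rewrite all_nseq /= ltnSn orbT.
  have := cat_overpartition _ _ _ s'a' ra.
  have nb : nonincreasing (nseq r (a, false)) && overlined_first_only (nseq r (a, false)).
    by case: (r) r0 => // r' _; exact: (block_overpartition a r'.+1 false).
  case/andP: novl nb => -> -> /andP[-> ->] /= /andP[-> ->].
  have -> : all (fun m => 0 < m) (parts (s' ++ nseq r (a, false))).
    rewrite /parts /unzip1 all_map all_cat all_nseq /= orbC; apply/andP; split; last by lia.
    by apply: sub_all s'a => y /=; lia.
  have -> : sumn (parts (s' ++ nseq r (a, false))) == n.
    rewrite /parts /unzip1 map_cat sumn_cat -/(parts s') sum_s' map_nseq sumn_nseq /=.
    by lia.
  have -> : (a, true) \notin s'.
    by apply/negP => /(allP s'a) /=; rewrite ltnn.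
  by rewrite xpair_eqE /= !andbF andbT; case/and4P: ar.
case/and3P=> /andP[/and3P[ni pos /eqP sum_s] ofo] ev nov.
set a := smallest_part s in ev nov.
have s0 : s != [::] by apply: contraTneq n0 => s0; rewrite -sum_s s0.
have ain : a \in parts s.
  rewrite /a /smallest_part; move: s0; case: (s) => // x s' _.
  by rewrite /parts /= mem_last.
have sa : all (fun x => a <= x.1) s.
  rewrite /a /smallest_part; case/lastP: (s) ni s0 => // s' x ni _.
  rewrite /parts /unzip1 map_rcons last_rcons all_rcons leqnn /=.
  move: ni; rewrite /nonincreasing -cats1 pairwise_cat => /andP[/allrelP H _].
  by apply/allP => y ys; apply: H => //; rewrite mem_seq1.
(* Cutting just above [a] leaves below only copies of [a], none overlined by [nov]. *)
have sE := nonincreasing_split a.+1 s ni.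
set u := [seq x <- s | a < x.1] in sE; set v := [seq x <- s | x.1 < a.+1] in sE.
have ua : all (fun x => a.+1 <= x.1) u by apply/allP => y; rewrite mem_filter => /andP[].
have va : all (fun x => x.1 < a.+1) v by apply/allP => y; rewrite mem_filter => /andP[].
have vE : v = nseq (size v) (a, false).
  apply/all_pred1P/allP => -[y c]; rewrite mem_filter /= ltnS => /andP[ya ys].
  have /= ay := allP sa _ ys; have yE : y = a by apply/eqP; rewrite eqn_leq ya.
  subst y; case: c ys => // ys; by rewrite ys in nov.
have : nonincreasing s && overlined_first_only s by rewrite ni.
rewrite {1 2}sE (@cat_overpartition _ _ a.+1) // => /and4P[niu ofou _ _].
have sum_uv : n = sumn (parts u) + a * size v.
  rewrite -sum_s [in LHS]sE /parts /unzip1 map_cat sumn_cat [in LHS]vE map_nseq sumn_nseq //=.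
have v0 : 0 < size v.
  case/mapP: ain => y ys ay; rewrite -has_predT; apply/hasP; exists y => //.
  by rewrite mem_filter ys -ay ltnSn.
have a0 : 0 < a by have := allP pos _ ain.
have an : a * size v <= n by rewrite sum_uv leq_addl.
have a_n : a <= n by apply: leq_trans an; rewrite leq_pmulr.
have v_n : size v <= n by apply: leq_trans an; rewrite leq_pmull.
exists (a, size v), u; split=> /=; last by rewrite -vE.
  by rewrite mem_smallest_blocks ev an a0 a_n v0.
have su : n - a * size v = sumn (parts u) by rewrite sum_uv addnK.
rewrite mem_overpartitions /overpartition_in niu ofou su.
apply/and3P; split=> //; apply/allP => y yu; rewrite (allP ua _ yu) /=.
have yn : y.1 <= n.
  by rewrite -sum_s; apply: leq_sumn; apply: map_f; move: yu; rewrite mem_filter => /andP[].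
exact: leq_trans yn (leq_addl _ _).
Qed.
(** The smallest part recovers a, its number of occurrences recovers r, and cancelling the tail
    recovers the rest. *)
Lemma spt2_overpartitions_uniq n : uniq (spt2_overpartitions n).
Proof.
apply: allpairs_uniq_dep => [|p _|].
- apply/filter_uniq/allpairs_uniq; rewrite ?iota_uniq //.
  by move=> [? ?] [? ?].
- exact: overpartitions_uniq.
- move=> [[a r] s] [[a' r'] s'] /allpairsPdep[p [t [pin tin E]]].
  case/allpairsPdep=> p' [t' [pin' tin' E']].
  have pE : (a, r) = p := congr1 tag E.
  have sE : s = t := congr1 (fun z : {_ & _} => (tagged z : marked_seq)) E.
  have pE' : (a', r') = p' := congr1 tag E'.
  have sE' : s' = t' := congr1 (fun z : {_ & _} => (tagged z : marked_seq)) E'.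
  subst p t p' t' => /= ss'.
  rewrite !mem_smallest_blocks in pin pin'.
  have aa' : a = a'.
    by move: (congr1 smallest_part ss'); rewrite !last_parts_nseq //; lia.
  subst a'.
  have small t y : t \in overpartitions a n y -> count (fun z => z.1 == a) t = 0.
    rewrite mem_overpartitions => /and3P[_ /allP sd _]; apply/eqP.
    by rewrite -leqn0 leqNgt -has_count; apply/hasP => -[z /sd /= zd /eqP zm]; lia.
  have rr' : r = r'.
    move: (congr1 (count (fun z => z.1 == a)) ss').
    rewrite !count_cat !count_nseq (small _ _ tin) // (small _ _ tin') //=.
    by rewrite eqxx; lia.
  subst r'; congr existT; apply/eqP.
  have szs : size s = size s'.
    by move: (congr1 size ss'); rewrite !size_cat !size_nseq => /addIn.
  by move/eqP: ss'; rewrite eqseq_cat // eqxx andbT.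
Qed.

Lemma num_smallest_nseq a r s y d : 0 < r -> s \in overpartitions a d y ->
  num_smallest (s ++ nseq r (a, false)) = r.
Proof.
move=> r0; rewrite mem_overpartitions => /and3P[_ /allP sd _].
rewrite /num_smallest last_parts_nseq // /parts /unzip1 map_cat count_cat map_nseq.
rewrite count_nseq /= eqxx mul1n; suff -> : count_mem a [seq i.1 | i <- s] = 0 by [].
by apply/count_memPn/negP => /mapP[z /sd /= zs az]; lia.
Qed.

Lemma marked_seq_of_tuple_inj n k : injective (@marked_seq_of_tuple n k).
Proof.
move=> t t' /inj_map E; apply/val_inj/E => -[x b] [y c] /= [/val_inj -> ->] //.
Qed.

Lemma spt2barE n : 0 < n ->
  spt2bar n = \sum_(s <- spt2_overpartitions n) num_smallest s.
Proof.
move=> n0.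
pose tuples (k : 'I_n.+1) := enum {: k.-tuple ('I_n.+1 * bool)}.
pose L := [seq marked_seq_of_tuple t | k <- enum 'I_n.+1, t <- tuples k].
have -> : spt2bar n =
    \sum_(s <- [seq s <- L | is_overpartition n s && smallest_even_nonoverlined s])
      num_smallest s.
  rewrite big_filter /L big_mkcond big_allpairs_dep /= /spt2bar -big_enum /=.
  by apply: eq_bigr => k _; rewrite big_enum -big_mkcond.
apply: perm_big; apply: uniq_perm.
- apply: filter_uniq; apply: allpairs_uniq_dep => [|k _|]; rewrite ?enum_uniq //.
  move=> [k t] [k' t'] _ _ /= E.
  have kk' : k = k'.
    by apply: val_inj; move: (congr1 size E); rewrite !size_map !size_tuple.
  by subst k'; rewrite (marked_seq_of_tuple_inj _ _ _ _ E).
- exact: spt2_overpartitions_uniq.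
move=> s; rewrite mem_spt2_overpartitions // mem_filter andb_idr // => /andP[ov _].
case/andP: ov; case/and3P=> _ pos /eqP sum_s _.
have sz : size s < n.+1.
  by rewrite ltnS -sum_s; apply: leq_trans (size_leq_sumn _ pos); rewrite size_map.
apply/allpairsPdep.
(* No part exceeds [n], so [inord] keeps its value. *)
exists (Ordinal sz), [tuple of [seq (inord x.1, x.2) | x <- in_tuple s]].
split; rewrite ?mem_enum // /marked_seq_of_tuple /= -map_comp map_id_in // => -[m b] ms.
rewrite /= inordK // ltnS -sum_s; apply: leq_sumn.
by apply/mapP; exists (m, b).
Qed.

Lemma spt2bar_sum n : 0 < n ->
  spt2bar n = \sum_(1 <= a < n.+1) \sum_(1 <= r < n.+1 | ~~ odd a && (a * r <= n))
                r * size (overpartitions a n (n - a * r)).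
Proof.
move=> n0; rewrite spt2barE // /spt2_overpartitions big_allpairs_dep /smallest_blocks.
rewrite big_filter big_mkcond big_allpairs /index_iota subSS subn0 /=.
apply: eq_bigr => a _; rewrite [RHS]big_mkcond big_seq [RHS]big_seq /=.
apply: eq_bigr => r; rewrite mem_iota => /andP[r0 _].
case: ifP => // _; rewrite -sum1_size big_distrr big_seq [RHS]big_seq /=.
by apply: eq_bigr => s sin; rewrite (num_smallest_nseq _ _ _ _ _ r0 sin) muln1.
Qed.

(** * From overpartitions to solution counts *)

Lemma sum_nat_even N (F : nat -> nat) : (forall a, odd a -> F a = 0) ->
  \sum_(1 <= a < (2 * N).+1) F a = \sum_(1 <= k < N.+1) F (2 * k).
Proof.
move=> F0; elim: N => [|N IH]; first by rewrite muln0 !big_geq.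
have -> : 2 * N.+1 = (2 * N).+2 by lia.
rewrite [RHS]big_nat_recr // -IH [LHS]big_nat_recr //; rewrite [in LHS]big_nat_recr // F0.
  by rewrite /= addn0; congr (_ + F _); lia.
by rewrite oddS oddM.
Qed.

Lemma even_divisor_sum N : 0 < N ->
  \sum_(1 <= a < (2 * N).+1) \sum_(1 <= r < (2 * N).+1) r * (~~ odd a && (a * r == 2 * N)) =
  \sum_(1 <= a < N.+1) \sum_(1 <= r < N.+1) r * (a * r == N).
Proof.
move=> N0; rewrite sum_nat_even; last first.
  by move=> a oa; rewrite big1 // => r _; rewrite oa muln0.
apply: eq_big_nat => a /andP[a0 _]; rewrite -(sum_nat_extend N); first last.
- move=> r r0 Nr; case: eqP => [E|_]; rewrite ?andbF ?muln0 //.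
  by suff : r <= a * r; [lia | rewrite leq_pmull].
- by lia.
apply: eq_bigr => r _; rewrite oddM /= -mulnA eqn_mul2l //.
Qed.

(** For each pair (a, r) the factor r multiplies the number of overpartitions of 2N - ar into larger
    parts. The empty ones add up to sigma(N); in the doubled remainder r matters only through its
    parity. *)
Lemma spt2bar_mod4 N : 0 < N ->
  spt2bar (2 * N) =
    \sum_(1 <= a < N.+1) \sum_(1 <= r < N.+1) r * (a * r == N)
    + 2 * cnt (4 * N) (fun a r b s =>
            [&& ~~ odd a, odd r, a * r + b * s == 2 * N & a < b]) %[mod 4].
Proof.
move=> N0; rewrite spt2bar_sum; last by lia.
(* [B] bounds a + n for every a up to n = 2N, as [size_overpartitions_mod4] requires. *)
rewrite -even_divisor_sum // cntE; set n := 2 * N; set B := 4 * N.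
have -> : \sum_(1 <= a < B.+1) \sum_(1 <= r < B.+1) \sum_(1 <= b < B.+1) \sum_(1 <= s < B.+1)
      [&& ~~ odd a, odd r, a * r + b * s == n & a < b] =
  \sum_(1 <= a < n.+1) \sum_(1 <= r < n.+1) \sum_(1 <= b < B.+1) \sum_(1 <= s < B.+1)
      [&& ~~ odd a, odd r, a * r + b * s == n & a < b].
  have large a r b s : 0 < a -> 0 < r -> (n < a) || (n < r) -> (a * r + b * s == n) = false.
    move=> a0 r0 nar; apply/eqP => E.
    have ? : a <= a * r by rewrite leq_pmulr.
    have ? : r <= a * r by rewrite leq_pmull.
    by case/orP: nar; lia.
  have nB : n <= B by rewrite /n /B; lia.
  rewrite -(sum_nat_extend n) //; last first.
    move=> a a0 na; rewrite big1_seq // => r; rewrite mem_index_iota => /and3P[_ r0 _].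
    by do 2 rewrite big1 // => ? _; rewrite large ?na // !andbF.
  apply: eq_big_nat => a /andP[a0 _]; rewrite -(sum_nat_extend n) // => r r0 nr.
  by do 2 rewrite big1 // => ? _; rewrite large ?nr ?orbT // !andbF.
rewrite big_distrr -big_split /= -modn_summ -[RHS]modn_summ; congr (_ %% 4).
apply: eq_big_nat => a /andP[a0 an]; rewrite big_distrr -big_split /= big_mkcond /=.
rewrite -modn_summ -[RHS]modn_summ; congr (_ %% 4).
apply: eq_big_nat => r /andP[r0 rn].
case: ifP => [/andP[ea arn]|nar]; last first.
  rewrite !big1 ?muln0 // => [|b _].
    by rewrite (_ : _ && _ = false) ?muln0 //; move: nar; case: odd => //=; lia.
  by rewrite big1 // => s _; move: nar; case: (odd a) => //=; lia.
rewrite -modnMmr (size_overpartitions_mod4 B) ?modnMmr; [|rewrite /B; lia | lia].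
have -> : (n - a * r == 0) = (a * r == n) by lia.
have -> : \sum_(1 <= b < B.+1) \sum_(1 <= s < B.+1) [&& ~~ odd a, odd r, a * r + b * s == n & a < b]
   = odd r * \sum_(1 <= b < B.+1) \sum_(1 <= s < B.+1) ((a < b <= a + n) && (b * s == n - a * r)).
  rewrite big_distrr; apply: eq_bigr => b _; rewrite big_distrr; apply: eq_big_nat => s /andP[s0 _].
  rewrite ea /= mulnb; congr nat_of_bool.
  have : b <= b * s by rewrite leq_pmulr.
  case: (odd r) => //=; lia.
rewrite ea mulnDr; apply/eqP; rewrite eqn_modDl; apply/eqP.
move: (\sum_(_ <= _ < _) _) => S; rewrite mulnCA.
have -> : r * S = odd r * S + 2 * (r./2 * S) by rewrite -{1}(odd_double_half r); lia.
lia.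
Qed.

Lemma cnt_shrink M B (P : nat -> nat -> nat -> nat -> bool) : M <= B ->
  (forall a r b s, (a, r, b, s) \in box B -> P a r b s -> (a, r, b, s) \in box M) ->
  cnt B P = cnt M P.
Proof.
move=> MB PM; rewrite /cnt -!size_filter; apply/perm_size/uniq_perm.
- exact/filter_uniq/box_uniq.
- exact/filter_uniq/box_uniq.
move=> [[[a r] b] s]; rewrite !mem_filter; apply: andb_id2l => Pt.
apply/idP/idP => [/PM/(_ Pt) //|]; rewrite !mem_box; lia.
Qed.

Lemma solution_box N a r b s : 0 < a -> 0 < r -> 0 < b -> 0 < s ->
  a * r + b * s = N -> (a, r, b, s) \in box N.
Proof.
move=> a0 r0 b0 s0 E; rewrite mem_box.
have ? : a <= a * r by rewrite leq_pmulr.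
have ? : r <= a * r by rewrite leq_pmull.
have ? : b <= b * s by rewrite leq_pmulr.
have ? : s <= b * s by rewrite leq_pmull.
lia.
Qed.

Lemma cnt_solution_shrink N B (C : nat -> nat -> nat -> nat -> bool) : N <= B ->
  cnt B (fun a r b s => (a * r + b * s == N) && C a r b s) =
  cnt N (fun a r b s => (a * r + b * s == N) && C a r b s).
Proof.
move=> NB; apply: cnt_shrink => // a r b s; rewrite mem_box => H /andP[/eqP E _].
by apply: solution_box; lia.
Qed.

(** As [a] is even and [b] odd, [s] is even; halving [a] and [s] turns [a < b] into [2 * a < b]. *)
Lemma cnt_two_parts_odd N :
  cnt (4 * N) (fun a r b s =>
    [&& ~~ odd a, odd r, a * r + b * s == 2 * N & a < b] && odd b) =
  cnt N (fun a r b s => [&& a * r + b * s == N, odd r, odd b & 2 * a < b]).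
Proof.
rewrite -(cnt_solution_shrink N (4 * N)); last by lia.
apply: (cnt_bij _ _ _ (fun '(a, r, b, s) => (a./2, r, b, s./2))
                      (fun '(a, r, b, s) => (2 * a, r, b, 2 * s))).
  move=> a r b s; rewrite mem_box => Hb /andP[/and4P[ea or /eqP E lt] ob].
  have es : ~~ odd s.
    by move: (congr1 odd E); rewrite oddD !oddM (negbTE ea) ob /= => ->.
  have [h hE] : exists h, a = 2 * h by exists a./2; lia.
  have [k kE] : exists k, s = 2 * k by exists s./2; lia.
  have -> : a./2 = h by lia.
  have -> : s./2 = k by lia.
  do 4 eexists; split; [reflexivity | rewrite mem_box; lia | | repeat congr pair; lia].
  by rewrite or ob /=; subst a s; apply/andP; split; lia.
move=> a r b s; rewrite mem_box => Hb /and4P[/eqP E or ob lt].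
have := solution_box N a r b s; rewrite mem_box => Hb'.
do 4 eexists; split; [reflexivity | rewrite mem_box; lia | | repeat congr pair; lia].
by rewrite or ob oddM /= andbT; apply/andP; split; lia.
Qed.

Lemma cnt_two_parts_even N :
  cnt (4 * N) (fun a r b s =>
    [&& ~~ odd a, odd r, a * r + b * s == 2 * N & a < b] && ~~ odd b) =
  cnt N (fun a r b s => [&& a * r + b * s == N, odd r & a < b]).
Proof.
rewrite -(cnt_solution_shrink N (4 * N)); last by lia.
apply: (cnt_bij _ _ _ (fun '(a, r, b, s) => (a./2, r, b./2, s))
                      (fun '(a, r, b, s) => (2 * a, r, 2 * b, s))).
  move=> a r b s; rewrite mem_box => Hb /andP[/and4P[ea or /eqP E lt] ob].
  have [h hE] : exists h, a = 2 * h by exists a./2; lia.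
  have [k kE] : exists k, b = 2 * k by exists b./2; lia.
  have -> : a./2 = h by lia.
  have -> : b./2 = k by lia.
  do 4 eexists; split; [reflexivity | rewrite mem_box; lia | | repeat congr pair; lia].
  by rewrite or /=; subst a b; apply/andP; split; lia.
move=> a r b s; rewrite mem_box => Hb /and3P[/eqP E or lt].
have := solution_box N a r b s; rewrite mem_box => Hb'.
do 4 eexists; split; [reflexivity | rewrite mem_box; lia | | repeat congr pair; lia].
by rewrite or !oddM /= andbT; apply/andP; split; lia.
Qed.

(** Splitting by the parity of [b] produces exactly the two counts that are doubled on the left of
    [divisor_sum_mod4]. *)
Lemma spt2bar_pair_mod4 N : odd N -> (forall x, x * x <> N) ->
  spt2bar (2 * N) =
    2 * (cnt N (fun a r b s => a * r + 2 * (b * s) == N)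
         + cnt N (fun a r b s => a * r + 4 * (b * s) == N)) %[mod 4].
Proof.
move=> oddN nsq; rewrite spt2bar_mod4; last by lia.
rewrite -divisor_sum_mod4 //; congr ((_ + 2 * _) %% 4).
by rewrite (cnt_split _ (fun a r b s => odd b)) cnt_two_parts_odd cnt_two_parts_even.
Qed.

Lemma spt2bar_3mul_mod4 M : odd M -> ~~ (3 %| M) -> (forall x, x * x <> M) ->
  spt2bar (2 * (3 * M)) = 0 %[mod 4].
Proof.
move=> oM nM nsq; rewrite spt2bar_pair_mod4 ?oddM //; last first.
  (* If 3M were a square, 9 would divide it. *)
  move=> x E; have : 3 %| x * x by rewrite E dvdn_mulr.
  rewrite Euclid_dvdM // orbb => /dvdnP[y xE].
  by case/negP: nM; apply/dvdnP; exists (y * y); subst x; lia.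
by have := even_cnt_3mul2 M oM nM nsq; have := even_cnt_3mul4 M nM; lia.
Qed.

Lemma spt2bar_1mod8_mod4 N : N %% 8 = 1 -> (forall x, x * x <> N) ->
  spt2bar (2 * N) = 0 %[mod 4].
Proof.
move=> N8 nsq; rewrite spt2bar_pair_mod4 //; last by lia.
by have := even_cnt_1mod8 N N8 nsq; lia.
Qed.

(** * The three progressions *)

Lemma square_mod3 x : (x * x) %% 3 <> 2.
Proof. by rewrite -modnMm; case: (x %% 3) (ltn_pmod x (isT : 0 < 3)) => [|[|[|]]]. Qed.

Lemma square_mod4 x : (x * x) %% 4 <> 3.
Proof. by rewrite -modnMm; case: (x %% 4) (ltn_pmod x (isT : 0 < 4)) => [|[|[|[|]]]]. Qed.

Theorem theorem1p1 (n : nat) :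
  [/\ spt2bar (36 * n + 30) = 0 %[mod 4],
      spt2bar (48 * n + 34) = 0 %[mod 4]
    & spt2bar (72 * n + 42) = 0 %[mod 4]].
Proof.
split.
(* 6n + 5 is 2 modulo 3, hence prime to 3 and not a square. *)
- have -> : 36 * n + 30 = 2 * (3 * (6 * n + 5)) by lia.
  by apply: spt2bar_3mul_mod4 => [||x]; [lia | lia | have := square_mod3 x; lia].
(* 24n + 17 is 1 modulo 8, and no square since it is 2 modulo 3. *)
- have -> : 48 * n + 34 = 2 * (24 * n + 17) by lia.
  by apply: spt2bar_1mod8_mod4 => [|x]; [lia | have := square_mod3 x; lia].
(* 12n + 7 is 1 modulo 3, and no square since it is 3 modulo 4. *)
- have -> : 72 * n + 42 = 2 * (3 * (12 * n + 7)) by lia.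
  by apply: spt2bar_3mul_mod4 => [||x]; [lia | lia | have := square_mod4 x; lia].
Qed.
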